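(* Let $n>2$ be an integer (odd or even) and $q\in\mathcal{B}_n$. If there exists a (balanced) $q$-nearly bent function in $\mathcal{B}_n$, then $\rho_q\equiv 0\pmod 4$ when $wt(q)$ is even, and $\rho_q\equiv 2\pmod 4$ when $wt(q)$ is odd.
   Context: $V_n=\{0,1\}^n$ (row vectors) and $\mathcal{B}_n$ is the set of Boolean functions $V_n\to\{0,1\}$. $wt(f)=|\{a: f(a)=1\}|$; $f$ is balanced if $wt(f)=2^{n-1}$. $W(f,g)=\sum_{a\in V_n}(-1)^{f(a)+g(a)}$. $GL_n$ is the group of invertible $n\times n$ matrices over $\mathbb{F}_2$; $q_A(a)=q(aA)$; $W_q(f)(A)=W(f,q_A)$. $I_q=\sum_{a\in V_n}(-1)^{q(a)}$ and $\rho_q=\left\lceil\left(\frac{2^{2n}-I_q^2}{2^n-1}\right)^{1/2}\right\rceil$. A balanced $f\in\mathcal{B}_n$ is called $q$-nearly bent if $|W_q(f)(A)|\le\rho_q$ for all $A\in GL_n$. *)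

(* Defs.v *)
From mathcomp Require Import all_boot all_order all_algebra.
From mathcomp Require Import reals.

Set Implicit Arguments.
Unset Strict Implicit.
Unset Printing Implicit Defensive.

Import Order.TTheory GRing.Theory Num.Theory.
Local Open Scope ring_scope.

Definition boolfun (n : nat) := {ffun 'rV['F_2]_n -> bool}.

Definition wt (n : nat) (f : boolfun n) : nat := #|[set a | f a]|.

Definition balanced (n : nat) (f : boolfun n) : Prop :=
  wt f = (2 ^ (n - 1))%N.

(* [f a + g a] is a sum in [nat], through the coercion [nat_of_bool]. *)
Definition W (n : nat) (f g : boolfun n) : int :=
  \sum_(a : 'rV['F_2]_n) (-1) ^+ (f a + g a)%N.

Definition actGL (n : nat) (q : boolfun n) (A : 'M['F_2]_n) : boolfun n :=
  [ffun a => q (a *m A)].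

Definition Wq (n : nat) (q f : boolfun n) (A : 'M['F_2]_n) : int :=
  W f (actGL q A).

Definition Iq (n : nat) (q : boolfun n) : int :=
  \sum_(a : 'rV['F_2]_n) (-1) ^+ (q a : nat).

Definition rho (R : realType) (n : nat) (q : boolfun n) : int :=
  Num.ceil (Num.sqrt ((2 ^+ (2 * n) - (Iq q)%:~R ^+ 2) / (2 ^+ n - 1) : R)).

Definition nearly_bent (R : realType) (n : nat) (q f : boolfun n) : Prop :=
  balanced f /\
  forall A : 'M['F_2]_n, A \in unitmx -> `|Wq q f A| <= rho R q.

(* Main.v *)
Require Import Defs.
From mathcomp Require Import all_boot all_order all_algebra.
From mathcomp Require Import reals ring zify.

(** Distinct nonzero vectors over F_2 are linearly independent, so GL_n acts
    2-transitively on them.  Averaging over GL_n therefore gives, for balanced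
    f, that W_q(f)^2 has mean exactly (2^(2n) - I_q^2) / (2^n - 1).  Hence some
    A has |W_q(f)(A)| >= rho_q, and near-bentness makes this an equality.
    Expanding (-1)^(x+y) = 1 - 2x - 2y + 4xy shows that W(f, q_A) is congruent
    to 2 wt(q) modulo 4, which transfers to rho_q. *)

Set Implicit Arguments.
Unset Strict Implicit.
Unset Printing Implicit Defensive.

Import Order.TTheory GRing.Theory Num.Theory.
Local Open Scope ring_scope.

(** * Transitivity of the general linear group *)

(** [pinvmx U *m V] carries [U] to [V] but may be singular; as it preserves the rank of [U], some
    invertible matrix agrees with it on the row space of [U]. *)
Lemma row_free_transitive (F : fieldType) (k n : nat) (U V : 'M[F]_(k, n)) :
  row_free U -> row_free V -> exists2 g : 'M[F]_n, g \in unitmx & U *m g = V.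
Proof.
move=> fU fV; have UfV : U *m (pinvmx U *m V) = V.
  by rewrite mulmxA mulmxVp // mul1mx.
have [|g gU eq_g] := @complete_unitmx F k n U (pinvmx U *m V).
  by rewrite UfV (eqP fU) (eqP fV).
by exists g => //; rewrite -eq_g.
Qed.

Lemma F2_eq0_or_eq1 (x : 'F_2) : x = 0 \/ x = 1.
Proof. by case: x => -[|[|m]] // ltm; [left | right]; apply/val_inj. Qed.

Lemma row_free_pair_F2 (n : nat) (a b : 'rV['F_2]_n) :
  a != 0 -> b != 0 -> a != b -> row_free (col_mx a b).
Proof.
move=> a0 b0 ab; apply: inj_row_free => v.
rewrite -[v]hsubmxK mul_row_col [lsubmx v]mx11_scalar [rsubmx v]mx11_scalar.
rewrite !mul_scalar_mx.
have [-> | ->] := F2_eq0_or_eq1 (lsubmx v 0 0);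
have [-> | ->] := F2_eq0_or_eq1 (rsubmx v 0 0);
  rewrite ?scale0r ?scale1r ?add0r ?addr0 => /eqP.
- by move=> _; rewrite raddf0 row_mx0.
- by rewrite (negPf b0).
- by rewrite (negPf a0).
- rewrite addr_eq0; have -> : - b = b.
    by apply/matrixP=> i j; rewrite mxE; case: (F2_eq0_or_eq1 (b i j)) => ->;
      apply/val_inj.
  by rewrite (negPf ab).
Qed.

Lemma row_free_rV (F : fieldType) (n : nat) (a : 'rV[F]_n) :
  a != 0 -> row_free a.
Proof. by move=> a0; rewrite /row_free rank_rV a0. Qed.

(** * Correlations of [q] summed over the group *)

Definition GLcorr (n : nat) (q : boolfun n) (a b : 'rV['F_2]_n) : int :=
  \sum_(A in unitmx) (-1) ^+ (q (a *m A) : nat) * (-1) ^+ (q (b *m A) : nat).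

Definition cardGL (n : nat) : int := #|[pred A : 'M['F_2]_n | A \in unitmx]|%:R.

Section Correlation.

Variables (n : nat) (q : boolfun n).
Implicit Types a b : 'rV['F_2]_n.

Lemma GLcorr_mul (g : 'M['F_2]_n) a b :
  g \in unitmx -> GLcorr q (a *m g) (b *m g) = GLcorr q a b.
Proof.
move=> gU; rewrite [RHS]/GLcorr (reindex (mulmx g)) /=; last first.
  by apply/onW_bij/(Bijective (mulKmx gU) (mulKVmx gU)).
by apply: eq_big => [A | A _]; rewrite ?unitmx_mul ?gU ?mulmxA.
Qed.

Lemma GLcorrC a b : GLcorr q a b = GLcorr q b a.
Proof. by apply: eq_bigr => A _; rewrite mulrC. Qed.

Lemma GLcorr_diag a : GLcorr q a a = cardGL n.
Proof.
rewrite /GLcorr (eq_bigr (fun=> 1)) => [|A _]; last by rewrite -expr2 sqrr_sign.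
by rewrite sumr_const.
Qed.

Lemma GLcorr_pair_const a b a' b' :
  a != 0 -> b != 0 -> a != b -> a' != 0 -> b' != 0 -> a' != b' ->
  GLcorr q a b = GLcorr q a' b'.
Proof.
move=> a0 b0 ab a0' b0' ab'.
have [g gU] := row_free_transitive (row_free_pair_F2 a0 b0 ab)
  (row_free_pair_F2 a0' b0' ab').
by rewrite mul_col_mx => /eq_col_mx [<- <-]; rewrite GLcorr_mul.
Qed.

Lemma GLcorr0_const a a' : a != 0 -> a' != 0 -> GLcorr q 0 a = GLcorr q 0 a'.
Proof.
move=> a0 a0'.
have [g gU <-] := row_free_transitive (row_free_rV a0) (row_free_rV a0').
by rewrite -[in RHS](mul0mx _ g) GLcorr_mul.
Qed.

(** [GLcorr] is constant on orbits of pairs: [t1] is its value when exactly one entry is 0, [t2] on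
    distinct nonzero entries, [cardGL n] on the diagonal. The last term corrects the overlap at (0,
    0). *)
Lemma GLcorr_values : exists t1 t2 : int, forall a b,
  GLcorr q a b = t2 + (t1 - t2) * ((a == 0)%:R + (b == 0)%:R)
    + (cardGL n - t2) * (a == b)%:R
    + 2 * (t2 - t1) * (a == 0)%:R * (b == 0)%:R.
Proof.
have [t1 t1P] : exists t, forall a, a != 0 -> GLcorr q 0 a = t.
  case: (pickP (fun a => a != 0)) => [a a0 | a0]; last first.
    by exists 0 => a; rewrite a0.
  by exists (GLcorr q 0 a) => b b0; apply: GLcorr0_const.
have [t2 t2P] : exists t, forall a b, a != 0 -> b != 0 -> a != b ->
    GLcorr q a b = t.
  pose P p := [&& p.1 != 0, p.2 != 0 & p.1 != p.2 :> 'rV['F_2]_n].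
  (* For n < 2 no such pair exists, and 0 is an arbitrary default. *)
  case: (pickP P) => [[a b] /and3P[a0 b0 ab] | P0]; last first.
    by exists 0 => a b a0 b0 ab; move: (P0 (a, b)); rewrite /P a0 b0 ab.
  by exists (GLcorr q a b) => a' b' *; apply: GLcorr_pair_const.
exists t1, t2 => a b.
have [-> | ab] := eqVneq a b.
  by rewrite GLcorr_diag; case: eqP => _ /=; ring.
have [a0 | a0] := eqVneq a 0; have [b0 | b0] := eqVneq b 0.
- by rewrite a0 b0 eqxx in ab.
- by rewrite a0 t1P //=; ring.
- by rewrite b0 GLcorrC t1P //=; ring.
- by rewrite t2P //=; ring.
Qed.

Lemma sum_GLcorr (h : 'rV['F_2]_n -> int) :
  \sum_(A in unitmx) (\sum_a h a * (-1) ^+ (q (a *m A) : nat)) ^+ 2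
  = \sum_a \sum_b h a * h b * GLcorr q a b.
Proof.
rewrite (eq_bigr (fun A : 'M_n => \sum_a \sum_b h a * h b *
   ((-1) ^+ (q (a *m A) : nat) * (-1) ^+ (q (b *m A) : nat)))); last first.
  move=> A _; rewrite expr2 big_distrlr /=.
  by apply: eq_bigr => a _; apply: eq_bigr => b _; rewrite mulrACA.
rewrite exchange_big; apply: eq_bigr => a _ /=.
rewrite exchange_big; apply: eq_bigr => b _ /=.
by rewrite mulr_sumr.
Qed.

Lemma Iq_actGL (A : 'M['F_2]_n) : A \in unitmx -> Iq (actGL q A) = Iq q.
Proof.
move=> AU; rewrite [RHS]/Iq (reindex (mulmxr A)) /=; last first.
  by apply/onW_bij/(Bijective (mulmxK AU) (mulmxKV AU)).
by apply: eq_bigr => a _; rewrite ffunE.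
Qed.

End Correlation.

(** * Second moment of [Wq q f] over the group *)

Lemma sum_delta (T : finType) (c : T) (F : T -> int) :
  \sum_a F a * (a == c)%:R = F c.
Proof.
rewrite (bigD1 c) //= eqxx mulr1 big1 ?addr0 // => a /negPf->.
by rewrite mulr0.
Qed.

Lemma sum_const_rVF2 (n : nat) (c : int) :
  \sum_(a : 'rV['F_2]_n) c = c * 2 ^+ n.
Proof.
by rewrite sumr_const card_mx card_Fp // mul1n -(mulr_natr c) natrX.
Qed.

(** The unknown [t1] and [t2] need not be computed: the quadratic form of [GLcorr] is evaluated at
    the signs of [f], whose sum is 0, and at the constant 1, and the two relations eliminate
    them. *)
Lemma sum_Wq_sqr (n : nat) (q f : boolfun n) : Iq f = 0 ->
  (2 ^+ n - 1) * (\sum_(A in unitmx) Wq q f A ^+ 2)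
  = cardGL n * (2 ^+ (2 * n) - Iq q ^+ 2).
Proof.
move=> If0; have [t1 [t2 tP]] := GLcorr_values q.
have quad (h : 'rV['F_2]_n -> int) : (forall a, h a ^+ 2 = 1) ->
    \sum_a \sum_b h a * h b * GLcorr q a b
    = t2 * (\sum_a h a) ^+ 2 + 2 * (t1 - t2) * h 0 * (\sum_a h a)
      + (cardGL n - t2) * 2 ^+ n + 2 * (t2 - t1).
  move=> hh; set S := \sum_a h a.
  transitivity (\sum_a (h a * (t2 * S + (t1 - t2) * h 0 )
    + (h a * ((t1 - t2) * S + 2 * (t2 - t1) * h 0)) * (a == 0)%:R
    + (cardGL n - t2))).
    apply: eq_bigr => a _.
    (* The summand is sorted by its indicator in [b] (none, [b == 0], [b == a]), so that [sum_delta]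
       applies. *)
    rewrite (eq_bigr (fun b => (h a * (t2 + (t1 - t2) * (a == 0)%:R)) * h b
      + (h a * ((t1 - t2) + 2 * (t2 - t1) * (a == 0)%:R) * h b) * (b == 0)%:R
      + ((cardGL n - t2) * h a * h b) * (b == a)%:R)); last first.
      by move=> b _; rewrite tP (eq_sym a b); ring.
    rewrite !big_split /= !sum_delta -mulr_sumr -/S.
    have -> : (cardGL n - t2) * h a * h a = cardGL n - t2.
      by rewrite -mulrA -expr2 hh mulr1.
    by ring.
  rewrite !big_split /= sum_delta -mulr_suml -/S !sum_const_rVF2.
  (* Restoring the factor [h 0 ^+ 2], equal to 1, makes this a polynomial identity. *)
  rewrite [X in _ = _ + X](_ : _ = 2 * (t2 - t1) * h 0 ^+ 2); first by ring.
  by rewrite hh mulr1.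
have -> : \sum_(A in unitmx) Wq q f A ^+ 2
    = (cardGL n - t2) * 2 ^+ n + 2 * (t2 - t1).
  pose F a : int := (-1) ^+ (f a : nat).
  rewrite (eq_bigr (fun A => (\sum_a F a * (-1) ^+ (q (a *m A) : nat)) ^+ 2)).
    rewrite sum_GLcorr quad; last by move=> a; rewrite sqrr_sign.
    by rewrite [\sum_a F a]If0; ring.
  by move=> A _; congr (_ ^+ 2); apply: eq_bigr => a _; rewrite exprD ffunE.
have : cardGL n * Iq q ^+ 2 = t2 * 2 ^+ n ^+ 2 + 2 * (t1 - t2) * 2 ^+ n
    + (cardGL n - t2) * 2 ^+ n + 2 * (t2 - t1).
  (* For [h] constantly 1, every invertible [A] contributes the same square [Iq q ^+ 2]. *)
  have := quad (fun=> 1) (fun=> expr1n _ 2).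
  rewrite -(sum_GLcorr q (fun=> 1)) sum_const_rVF2 mul1r mulr1 => <-.
  rewrite (eq_bigr (fun=> Iq q ^+ 2)) => [|A AU].
    by rewrite sumr_const mulr_natl.
  rewrite -(Iq_actGL q AU); congr (_ ^+ 2).
  by apply: eq_bigr => a _; rewrite ffunE mul1r.
by move=> eqI; rewrite [RHS]mulrBr eqI mulnC exprM; ring.
Qed.

(** * Weights and residues modulo 4 *)

Lemma wt_sum (n : nat) (f : boolfun n) : (wt f)%:R = \sum_a (f a)%:R :> int.
Proof.
rewrite -natr_sum /wt -sum1_card big_mkcond /=; congr (_%:R).
by apply: eq_bigr => a _; rewrite inE; case: (f a).
Qed.

Lemma Iq_wt (n : nat) (f : boolfun n) : Iq f = 2 ^+ n - 2 * (wt f)%:R.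
Proof.
rewrite /Iq (eq_bigr (fun a => 1 - 2 * (f a)%:R)).
  by rewrite sumrB -mulr_sumr -wt_sum sum_const_rVF2 mul1r.
by move=> a _; case: (f a).
Qed.

Lemma W_wt (n : nat) (f g : boolfun n) : exists k : int,
  W f g = 2 ^+ n - 2 * (wt f)%:R - 2 * (wt g)%:R + 4 * k.
Proof.
(* The witness is the size of the common support. *)
exists (\sum_a (f a && g a)%:R).
rewrite !wt_sum !mulr_sumr.
have -> : 2 ^+ n = \sum_(a : 'rV['F_2]_n) 1 :> int.
  by rewrite sum_const_rVF2 mul1r.
rewrite -!sumrB -big_split /=; apply: eq_bigr => a _.
by case: (f a); case: (g a).
Qed.

Lemma Iq_balanced (n : nat) (f : boolfun n) :
  (0 < n)%N -> balanced f -> Iq f = 0.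
Proof.
case: n f => // n f _ bf.
by rewrite Iq_wt bf subn1 /= natrX exprS subrr.
Qed.

Lemma Wq_mod4 (n : nat) (q f : boolfun n) (A : 'M['F_2]_n) :
  (1 < n)%N -> balanced f -> A \in unitmx ->
  exists k : int, Wq q f A = 2 * (odd (wt q))%:R + 4 * k.
Proof.
case: n q f A => [|[|n]] // q f A _ bf AU.
have [k Wk] := W_wt f (actGL q A).
have -> : Wq q f A = W f (actGL q A) by [].
have wtA : (wt (actGL q A))%:R = (wt q)%:R :> int.
  by have := Iq_actGL q AU; rewrite !Iq_wt; lia.
rewrite Wk wtA bf subn1 /= natrX !exprS.
have -> : (wt q)%:R = (odd (wt q))%:R + 2 * ((wt q)./2)%:R :> int.
  by rewrite -{1}(odd_double_half (wt q)) -muln2; lia.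
(* Balancedness cancels [2 ^+ n]; in what remains, -2x is rewritten as 2x - 4x for the parity bit
   x. *)
by exists (k - (odd (wt q))%:R - ((wt q)./2)%:R); ring.
Qed.

(** If the bound were strict everywhere, each square would lie strictly below the real number [X]
    under the root, contradicting that their mean is [X]. *)
Lemma nearly_bent_attained (R : realType) (n : nat) (q f : boolfun n) :
  (0 < n)%N -> nearly_bent R q f ->
  exists2 A, A \in unitmx & `|Wq q f A| = rho R q.
Proof.
move=> n0 [bf le_rho].
case: (pickP (fun A => (A \in unitmx) && (`|Wq q f A| == rho R q))) => [A|noA].
  by case/andP=> AU /eqP; exists A.
exfalso.
set X : R := (2 ^+ (2 * n) - (Iq q)%:~R ^+ 2) / (2 ^+ n - 1).
have ltX A : A \in unitmx -> (Wq q f A)%:~R ^+ 2 < X.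
  move=> AU; have : `|Wq q f A| < rho R q.
    by rewrite lt_neqAle le_rho // andbT; move: (noA A); rewrite AU /= => ->.
  (* An integer below a ceiling is below the real number itself, so rounding loses nothing. *)
  rewrite /rho ceil_gt_int -/X => lt_sqrt.
  (* [Num.sqrt] is 0 on negative numbers, so positivity of [X] must precede squaring the root. *)
  have X0 : 0 < X.
    by rewrite -sqrtr_gt0; apply: le_lt_trans lt_sqrt; rewrite ler0z.
  rewrite -(sqr_sqrtr (ltW X0)) -real_normK ?num_real // -intr_norm.
  by rewrite ltr_pXn2r ?nnegrE ?ler0z ?sqrtr_ge0.
have N1 : 0 < 2 ^+ n - 1 :> R by rewrite subr_gt0 exprn_egt1 ?ltr1n // -lt0n.
have : \sum_(A in [pred A : 'M['F_2]_n | A \in unitmx]) ((Wq q f A)%:~R ^+ 2)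
    < \sum_(A in [pred A : 'M['F_2]_n | A \in unitmx]) X.
  apply: ltr_sum => [|A AU]; last exact: ltX.
  (* Strictness of the summed inequality requires a nonempty index set. *)
  apply/hasP; exists 1%:M; first by rewrite mem_index_enum.
  by rewrite !inE unitmx1.
have XN : (2 ^+ n - 1) * X = 2 ^+ (2 * n) - (Iq q)%:~R ^+ 2.
  by rewrite mulrC divfK // gt_eqF.
rewrite sumr_const -(ltr_pM2l N1) [ltRHS]mulrnAr XN.
have := congr1 (fun z : int => z%:~R : R) (sum_Wq_sqr q (Iq_balanced n0 bf)).
rewrite /= [LHS]rmorphM [RHS]rmorphM !rmorphB !rmorphXn rmorph_nat rmorph1 /=.
rewrite rmorph_sum /= (eq_bigr (fun A => (Wq q f A)%:~R ^+ 2)) => [->|A _].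
  by rewrite [cardGL n]/cardGL rmorph_nat mulr_natl ltxx.
by rewrite rmorphXn.
Qed.

Theorem theorem3 (R : realType) (n : nat) (hn : (2 < n)%N) (q : boolfun n) :
  (exists f : boolfun n, nearly_bent R q f) ->
  (~~ odd (wt q) -> (rho R q = 0 %[mod 4])%Z) /\
  (odd (wt q) -> (rho R q = 2 %[mod 4])%Z).
Proof.
case=> f nbf; have [A AU <-] := nearly_bent_attained (ltnW (ltnW hn)) nbf.
have [k ->] := Wq_mod4 q (ltnW hn) (proj1 nbf) AU.
(* The absolute value is harmless, as 2 and -2 agree modulo 4. *)
by case: (odd (wt q)); split=> // _; lia.
Qed.
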